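(* Let $0<\delta<1$ and $p\ge 1$ (with $p<\infty$) be such that $\alpha=\delta-1/p>0$. Set $q=1/\delta$. Then for every $h\in W^{\delta,p}$, the map $$\omega(s,t)=|h|_{W^{\delta,p};[s,t]}^{q}\,(t-s)^{\alpha q},\qquad 0\le s\le t\le 1,$$ is a control function, and the $q$-variation of $h$ is controlled by a constant multiple of $\omega$: there is a constant $C$ depending only on $\delta$ and $p$ such that $|h|_{q\text{-var};[s,t]}^{q}\le C\,\omega(s,t)$ for all $0\le s\le t\le 1$. Moreover, one has the continuous embeddings $$W^{\delta,p}\subset C^{\alpha\text{-H\''older}}\quad\text{and}\quad W^{\delta,p}\subset C^{q\text{-var}}.$$
   Context: All paths are real-valued functions on $[0,1]$. For $\delta\in(0,1)$, $p\in(1,\infty)$, a measurable path $h:[0,1]\to\mathbb{R}$ and $0\le s\le t\le1$, set $$|h|_{W^{\delta,p};[s,t]}=\left(\int\!\!\int_{[s,t]^2}\frac{|h_v-h_u|^p}{|v-u|^{1+\delta p}}\,du\,dv\right)^{1/p}\in[0,\infty],\qquad |h|_{W^{\delta,p}}=|h|_{W^{\delta,p};[0,1]}.$$ $W^{\delta,p}$ is the set of $h$ with $|h|_{L^p}+|h|_{W^{\delta,p}}<\infty$; it is a Banach space with this norm. (Note that $\delta<1$ and $\delta-1/p>0$ force $p>1$.) As usual, elements of $W^{\delta,p}$ are identified when equal a.e., and for $1>\delta>1/p>0$ each $h\in W^{\delta,p}$ is taken to be its continuous representative. A control function is a continuous map $(s,t)\mapsto\omega(s,t)\in[0,\infty)$,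 defined for $0\le s\le t\le 1$, which is super-additive: $\omega(s,t)+\omega(t,u)\le\omega(s,u)$ for $s\le t\le u$. For $q\ge1$, $|h|_{q\text{-var};[s,t]}=\sup\left(\sum_i|h_{t_{i+1}}-h_{t_i}|^q\right)^{1/q}$, the supremum being over all finite partitions $(t_i)$ of $[s,t]$. $C^{q\text{-var}}$ is the space of continuous paths $h$ with $|h|_{q\text{-var};[0,1]}<\infty$, with norm $\sup_{[0,1]}|h|+|h|_{q\text{-var};[0,1]}$. $C^{\alpha\text{-H\''older}}$ is the space of paths with $|h|_{\alpha\text{-H\''older}}=\sup_{0\le s<t\le1}|h_t-h_s|/|t-s|^\alpha<\infty$, with norm $\sup_{[0,1]}|h|+|h|_{\alpha\text{-H\''older}}$. A continuous embedding is an inclusion that is a bounded linear map. *)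

(* Defs.v *)
From HB Require Import structures.
From mathcomp Require Import all_boot all_order all_algebra.
From mathcomp Require Import all_classical all_reals all_analysis.

Set Implicit Arguments.
Unset Strict Implicit.
Unset Printing Implicit Defensive.
Import Order.TTheory GRing.Theory Num.Theory.
Import numFieldNormedType.Exports.

Local Open Scope classical_set_scope.
Local Open Scope ring_scope.
Local Open Scope ereal_scope.

(* A path on [0,1] is a function R -> R of which only the values on [0,1] are
   used. *)

Section paths.
Context {R : realType}.
Implicit Types (h g : R -> R) (delta p q alpha s t : R).

Local Notation mu := (@lebesgue_measure R).
Local Notation I01 := (`[0%R, 1%R]%classic : set R).

(* On the diagonal (a null set) the quotient is 0 / 0 = 0. *)
Definition slobodeckij delta p h s t : \bar R :=
  (\int[mu \x mu]_(z in `[s, t] `*` `[s, t])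
     ((`|h z.2 - h z.1| `^ p / `|z.2 - z.1| `^ (1 + delta * p))%R)%:E)
  `^ p^-1.

Definition sobolev_norm delta p h : \bar R :=
  'N[mu]_(p%:E)[EFin \o (h \_ I01)] + slobodeckij delta p h 0 1.

Definition sobolev delta p : set (R -> R) :=
  [set h | measurable_fun I01 h /\ sobolev_norm delta p h < +oo].

(* Elements of [sobolev] are functions, not a.e.-classes; [g] is the continuous
   representative of the class of [h]. *)
Definition continuous_representative h g : Prop :=
  {within I01, continuous g} /\ ae_eq mu I01 h g.

Definition simplex : set (R * R) :=
  [set z | [/\ 0 <= z.1, z.1 <= z.2 & z.2 <= 1]%R].

Definition control_function (w : R -> R -> \bar R) : Prop :=
  [/\ forall s t, simplex (s, t) -> 0 <= w s t < +oo,
      {within simplex, continuous (fun z => w z.1 z.2)} &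
      forall s t u, (0 <= s)%R -> (s <= t)%R -> (t <= u)%R -> (u <= 1)%R ->
        w s t + w t u <= w s u].

(* As in the library's [variation], a partition a = t_0 < ... < t_n = b is
   given by the list of t_1, ..., t_n. *)
Definition qvar q h (a b : R) : \bar R :=
  ereal_sup [set ((\sum_(0 <= i < size l)
      `|h (nth b (a :: l) i.+1) - h (nth b (a :: l) i)| `^ q) `^ q^-1)%R%:E
    | l in [set l : seq R | itv_partition a b l]].

Definition sup_norm h : \bar R :=
  ereal_sup [set `|h x|%R%:E | x in I01].

Definition holder_seminorm alpha h : \bar R :=
  ereal_sup [set (`|h z.2 - h z.1| / `|z.2 - z.1| `^ alpha)%R%:E
    | z in [set z : R * R | [/\ 0 <= z.1, z.1 < z.2 & z.2 <= 1]%R]].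

Definition holder_space alpha : set (R -> R) :=
  [set h | holder_seminorm alpha h < +oo].

Definition holder_norm alpha h : \bar R := sup_norm h + holder_seminorm alpha h.

Definition qvar_space q : set (R -> R) :=
  [set h | {within I01, continuous h} /\ qvar q h 0 1 < +oo].

Definition qvar_norm q h : \bar R := sup_norm h + qvar q h 0 1.

(* Inclusion of a space X of a.e.-classes into a space Y of paths, as a bounded
   linear map: [J] picks the representative, continuous on [0,1], that lies
   in Y.  When [X] is invariant under a.e. equality on [0,1], [J] is determined
   on [0,1], hence well defined on classes. *)
Definition continuous_embedding (X : set (R -> R)) (normX : (R -> R) -> \bar R)
    (Y : set (R -> R)) (normY : (R -> R) -> \bar R) : Prop :=
  exists J : (R -> R) -> (R -> R),
  [/\ forall h, X h -> continuous_representative h (J h) /\ Y (J h),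
      forall (a : R) h1 h2, X h1 -> X h2 ->
        X (fun x => a * h1 x + h2 x)%R /\
        {in I01, forall x,
          J (fun y => a * h1 y + h2 y) x = a * J h1 x + J h2 x}%R &
      exists C : R, forall h, X h -> normY (J h) <= C%:E * normX h].

End paths.

(* Main.v *)
(* For intervals [c, d] inside [a, b], averaging |h u - h v| over
   (u, v) in [c, d] x [a, b] bounds the difference of the averages of h on
   [c, d] and on [a, b] by C (b - a)^alpha |h|_{W;[a,b]}, with C depending only
   on the ratio of the lengths.  Summing over intervals shrinking geometrically
   to x (Campanato's argument), the averages converge to a limit J h x, with
   |J h y - J h x| <= 2 K (y - x)^alpha |h|_{W;[x,y]}.  By Lebesgue
   differentiation J h = h a.e., so J h is the continuous representative.
   Hoelder's inequality makes
   omega = (|h|_{W;[s,t]}^p)^(1 / (delta p)) (t - s)^(1 - 1 / (delta p))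
   super-additive, and the pointwise bound raised to the power 1 / delta reads
   |J h y - J h x|^q <= (2 K)^q omega(x, y), which sums over partitions. *)

Require Import Defs.
From HB Require Import structures.
From mathcomp Require Import all_boot all_order all_algebra.
From mathcomp Require Import all_classical all_reals all_analysis.
From mathcomp Require Import measurable_realfun ring lra.
Import Order.TTheory GRing.Theory Num.Theory.
Import numFieldNormedType.Exports.

Set Implicit Arguments.
Unset Strict Implicit.
Unset Printing Implicit Defensive.

Local Open Scope classical_set_scope.
Local Open Scope ring_scope.

Lemma ge0_le_integral_overlap d (T : measurableType d) (R : realType)
    (mu : {measure set T -> \bar R}) (A B C : set T) (f : T -> \bar R) :
  measurable A -> measurable B -> measurable C ->
  measurable_fun setT f -> (forall x, (0 <= f x)%E) ->
  (forall x, A x -> B x -> f x = 0%E) -> A `<=` C -> B `<=` C ->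
  (\int[mu]_(x in A) f x + \int[mu]_(x in B) f x <=
   \int[mu]_(x in C) f x)%E.
Proof.
move=> mA mB mC mf f0 fAB AC BC.
have mfr D : measurable D -> measurable_fun setT (f \_ D).
  by move=> mD; apply/(measurable_restrictT _ _).1 => //; exact: measurable_funTS.
rewrite (integral_mkcond A) (integral_mkcond B) (integral_mkcond C).
rewrite -ge0_integralD//; last 4 first.
- by move=> x _; exact: erestrict_ge0.
- exact: mfr.
- by move=> x _; exact: erestrict_ge0.
- exact: mfr.
apply: ge0_le_integral => //.
- by move=> x _; apply: adde_ge0; exact: erestrict_ge0.
- by apply: emeasurable_funD; exact: mfr.
- exact: mfr.
move=> x _; rewrite !patchE.
case: ifPn => [/set_mem xA|_]; case: ifPn => [/set_mem xB|_].
- by rewrite fAB// adde0; case: ifP.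
- by rewrite adde0 mem_set//; exact: AC.
- by rewrite add0e mem_set//; exact: BC.
- by rewrite adde0; case: ifP.
Qed.

Section energy.
Context {R : realType}.
Implicit Types (h : R -> R) (delta p s t : R).
Local Notation mu := (@lebesgue_measure R).
Local Notation sq s t := (`[s, t] `*` `[s, t] : set (R * R)).

Definition slobodeckij_kernel delta p h (z : R * R) : R :=
  `|h z.2 - h z.1| `^ p / `|z.2 - z.1| `^ (1 + delta * p).

Definition energy delta p h s t : \bar R :=
  (\int[mu \x mu]_(z in sq s t) (slobodeckij_kernel delta p h z)%:E)%E.

Lemma slobodeckijE delta p h s t :
  slobodeckij delta p h s t = (energy delta p h s t `^ p^-1)%E.
Proof. by []. Qed.

Lemma measurable_sq s t : measurable (sq s t).
Proof. exact: measurableX. Qed.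
Hint Resolve measurable_sq : core.

Lemma slobodeckij_kernel_ge0 delta p h z : 0 <= slobodeckij_kernel delta p h z.
Proof. by rewrite divr_ge0 ?powR_ge0. Qed.

Lemma measurable_slobodeckij_kernel delta p h :
  measurable_fun setT h -> measurable_fun setT (slobodeckij_kernel delta p h).
Proof.
move=> mh.
have m1 : measurable_fun setT (fun z : R * R => h z.2 - h z.1).
  by apply: measurable_funB; apply: measurableT_comp.
have m2 : measurable_fun setT (fun z : R * R => z.2 - z.1).
  by apply: measurable_funB.
rewrite /slobodeckij_kernel; under eq_fun => z do rewrite -powRN.
apply: measurable_funM.
  by apply: (measurableT_comp (measurable_powR _)); exact: measurableT_comp.
by apply: (measurableT_comp (measurable_powR _)); exact: measurableT_comp.
Qed.

Lemma energy_ge0 delta p h s t : (0 <= energy delta p h s t)%E.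
Proof.
by apply: integral_ge0 => z _; rewrite lee_fin slobodeckij_kernel_ge0.
Qed.

Lemma eq_energy delta p h g s t : {in `[s, t], h =1 g} ->
  energy delta p h s t = energy delta p g s t.
Proof.
move=> hg; apply: eq_integral => z /set_mem [/= z1 z2].
by rewrite /slobodeckij_kernel !hg.
Qed.

Lemma le_energy delta p h s t a b : measurable_fun setT h ->
  a <= s -> t <= b ->
  (energy delta p h s t <= energy delta p h a b)%E.
Proof.
move=> mh sa tb; apply: ge0_subset_integral.
- exact: measurable_sq.
- exact: measurable_sq.
- have : measurable_fun setT (EFin \o slobodeckij_kernel delta p h).
    by apply/measurable_EFinP; exact: measurable_slobodeckij_kernel.
  by move=> mk; exact: (measurable_funTS mk).
- by move=> z _; rewrite (lee_fin 0) slobodeckij_kernel_ge0.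
- by move=> z [/= z1 z2]; split => /=;
    [move: z1|move: z2]; rewrite !in_itv /= => /andP[? ?]; apply/andP; split;
    lra.
Qed.

Lemma energyD delta p h s t u : p != 0 -> measurable_fun setT h ->
  s <= t -> t <= u ->
  (energy delta p h s t + energy delta p h t u <= energy delta p h s u)%E.
Proof.
move=> p0 mh st tu.
have mk : measurable_fun setT (EFin \o slobodeckij_kernel delta p h).
  by apply/measurable_EFinP; exact: measurable_slobodeckij_kernel.
apply: ge0_le_integral_overlap.
- exact: measurable_sq.
- exact: measurable_sq.
- exact: measurable_sq.
- exact: mk.
- by move=> z; rewrite (lee_fin 0) slobodeckij_kernel_ge0.
- move=> z [/= + +] [/= + +]; rewrite !in_itv /=.
  move=> /andP[a1 a2] /andP[a3 a4] /andP[a5 a6] /andP[a7 a8].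
  have e1 : z.1 = t by lra.
  have e2 : z.2 = t by lra.
  by rewrite /slobodeckij_kernel e1 e2 !subrr normr0 powR0// mul0r.
- move=> z [/= + +]; rewrite !in_itv/= => /andP[a1 a2] /andP[a3 a4].
  by split => /=; apply/andP; split; lra.
- move=> z [/= + +]; rewrite !in_itv/= => /andP[a1 a2] /andP[a3 a4].
  by split => /=; apply/andP; split; lra.
Qed.

End energy.

Lemma le_Rintegral_setD d (T : measurableType d) (R : realType)
    (mu : {measure set T -> \bar R}) (f : T -> R) :
  mu.-integrable setT (EFin \o f) -> (forall x, 0 <= f x) ->
  forall e : R, 0 < e -> exists2 r : R, 0 < r &
    forall A B : set T, measurable A -> measurable B -> (mu (A `\` B) < r%:E)%E ->
    \int[mu]_(x in A) f x <= \int[mu]_(x in B) f x + e.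
Proof.
move=> intf f0 e e0.
have [r [r0 cf]] := integral_normr_continuous intf e0.
exists r => // A B mA mB ABr.
have intS D : measurable D -> mu.-integrable D (EFin \o f).
  by move=> mD; exact: integrableS intf.
have mD : measurable (A `\` B) by exact: measurableD.
have mI : measurable (A `&` B) by exact: measurableI.
have -> : \int[mu]_(x in A) f x =
    \int[mu]_(x in A `&` B) f x + \int[mu]_(x in A `\` B) f x.
  rewrite -Rintegral_setU ?setUIDK//.
    exact: intS.
  by rewrite disj_set2E; apply/eqP; rewrite setDE setIACA setICr setI0.
apply: lerD.
  rewrite /Rintegral fine_le//.
  - by apply: integrable_fin_num => //; exact: intS.
  - by apply: integrable_fin_num => //; exact: intS.
  apply: ge0_subset_integral => //.
    by apply: (measurable_int mu); exact: intS.
  by move=> x _; rewrite lee_fin.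
apply: le_trans (ltW (cf _ mD ABr)).
by under [leRHS]eq_Rintegral do rewrite ger0_norm//.
Qed.

Lemma ge0_integrable_patch d (T : measurableType d) (R : realType)
    (mu : {measure set T -> \bar R}) (D : set T) (f : T -> R) :
  measurable D -> measurable_fun setT (EFin \o f) -> (forall x, 0 <= f x) ->
  (\int[mu]_(x in D) (f x)%:E < +oo)%E ->
  mu.-integrable setT (EFin \o (f \_ D)).
Proof.
move=> mD mf f0 foo; rewrite -restrict_EFin; apply: (iffLR (integrable_mkcond _ mD)).
apply/integrableP; split; first exact: (measurable_funTS mf).
apply: le_lt_trans foo.
by under eq_integral do rewrite gee0_abs ?lee_fin//.
Qed.

Section energy_continuity.
Context {R : realType}.
Implicit Types (h : R -> R) (delta p s t : R).
Local Notation mu := (@lebesgue_measure R).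
Local Notation sq s t := (`[s, t] `*` `[s, t] : set (R * R)).

Lemma measure_sqD s t s' t' : 0 <= s -> t <= 1 ->
  ((mu \x mu)%E (sq s t `\` sq s' t') <=
    (2 * (`|s - s'| + `|t - t'|))%:E)%E.
Proof.
move=> s0 t1.
pose W : set R := `[s, s'] `|` `[t', t].
pose I : set R := `[0, 1]%classic.
have mW : measurable W by exact: measurableU.
have mI : measurable I by exact: measurable_itv.
have mu_itv (a b : R) : (mu `[a, b]%classic <= `|b - a|%:E)%E.
  rewrite lebesgue_measure_itv/= lte_fin; case: ifPn => ab.
    by rewrite -EFinB lee_fin ler_norm.
  by rewrite lee_fin.
have mmW : (mu W <= (`|s - s'| + `|t - t'|)%:E)%E.
  apply: (le_trans (measureU2 _ _ _)) => //.
  by rewrite EFinD (distrC s); apply: leeD; exact: mu_itv.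
have mmI : mu I = 1%E.
  by rewrite lebesgue_measure_itv/= lte_fin ltr01 sube0.
apply: (@le_trans _ _ ((mu \x mu)%E ((W `*` I) `|` (I `*` W)))).
  apply: le_measure; rewrite ?inE.
  - by apply: measurableD; exact: measurable_sq.
  - by apply: measurableU; exact: measurableX.
  move=> [x y] [/= [+ +]]; rewrite !in_itv/= => /andP[sx xt] /andP[sy yt] nB.
  have Ix : I x by rewrite /I /= in_itv/=; apply/andP; split; lra.
  have Iy : I y by rewrite /I /= in_itv/=; apply/andP; split; lra.
  have Wx z : s <= z -> z <= t -> z < s' \/ t' < z -> W z.
    by move=> ? ? [?|?]; [left|right]; rewrite /= in_itv/=; apply/andP; split; lra.
  have [xs|xs] := ltP x s'; first by left; split => //; apply: Wx => //; left.
  have [xt'|xt'] := ltP t' x; first by left; split => //; apply: Wx => //; right.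
  have [ys|ys] := ltP y s'; first by right; split => //; apply: Wx => //; left.
  have [yt'|yt'] := ltP t' y; first by right; split => //; apply: Wx => //; right.
  by exfalso; apply: nB; split => /=; apply/andP; split.
apply: (le_trans (measureU2 _ _ _)); try exact: measurableX.
have -> : (2 * (`|s - s'| + `|t - t'|))%:E =
  ((`|s - s'| + `|t - t'|)%:E + (`|s - s'| + `|t - t'|)%:E)%E.
  by rewrite -EFinD; congr EFin; ring.
have e1 : (mu \x mu)%E (W `*` I) = mu W.
  exact: (etrans (product_measure1E mu mu mW mI)
    (etrans (f_equal (fun z => mu W * z)%E mmI) (mule1 _))).
have e2 : (mu \x mu)%E (I `*` W) = mu W.
  exact: (etrans (product_measure1E mu mu mI mW)
    (etrans (f_equal (fun z => z * mu W)%E mmI) (mul1e _))).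
by apply: leeD; [apply: le_trans mmW; rewrite -e1|
  apply: le_trans mmW; rewrite -e2].
Qed.

Lemma energy_continuity delta p h : measurable_fun setT h ->
  (energy delta p h 0 1 < +oo)%E ->
  forall e : R, 0 < e -> exists2 r : R, 0 < r & forall s t s' t' : R,
    0 <= s -> t <= 1 -> 0 <= s' -> t' <= 1 -> `|s - s'| < r -> `|t - t'| < r ->
    fine (energy delta p h s t) <= fine (energy delta p h s' t') + e.
Proof.
move=> mh hoo e e0.
pose f := (slobodeckij_kernel delta p h \_ (sq 0 1)).
have mk : measurable_fun setT (EFin \o slobodeckij_kernel delta p h).
  by apply/measurable_EFinP; exact: measurable_slobodeckij_kernel.
have f0 z : 0 <= f z.
  by rewrite /f patchE; case: ifP => // _; exact: slobodeckij_kernel_ge0.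
have intf : (mu \x mu)%E.-integrable setT (EFin \o f).
  apply: ge0_integrable_patch.
  - exact: measurable_sq.
  - exact: mk.
  - by move=> z; exact: slobodeckij_kernel_ge0.
  - exact: hoo.
have [r r0 rP] := le_Rintegral_setD intf f0 e0.
exists (r / 4) => [|s t s' t' s0 t1 s'0 t'1 ss tt]; first lra.
have fE a b : 0 <= a -> b <= 1 ->
    fine (energy delta p h a b) = (\int[(mu \x mu)%E]_(z in sq a b) f z)%R.
  move=> a0 b1; rewrite /Rintegral /energy; congr fine.
  apply: eq_integral => z /set_mem[/= + +].
  rewrite !in_itv/= => /andP[a2 a3] /andP[a4 a5].
  rewrite /f patchE mem_set//.
  by split; rewrite /= in_itv/=; apply/andP; split; lra.
rewrite !fE//; apply: rP.
- exact: measurable_sq.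
- exact: measurable_sq.
apply: (le_lt_trans (measure_sqD _ _ _ _)) => //.
by rewrite lte_fin; lra.
Qed.

End energy_continuity.

Lemma young_powR (R : realType) (p a c : R) :
  1 <= p -> 0 <= a -> 0 < c -> a <= c + c `^ (1 - p) * a `^ p.
Proof.
move=> p1 a0 c0; have [ac|ca] := leP a c.
  by rewrite (le_trans ac)// lerDl mulr_ge0 ?powR_ge0.
have {}a0 : 0 < a by rewrite (lt_trans c0).
rewrite (@le_trans _ _ (c `^ (1 - p) * a `^ p)) ?lerDr ?(ltW c0)//.
rewrite [leLHS](_ : _ = a `^ (1 - p) * a `^ p); last first.
  by rewrite -powRD ?addrNK ?powRr1 ?(ltW a0)// (gt_eqF a0) implybT.
rewrite ler_wpM2r ?powR_ge0// -(opprB p 1) !powRN lef_pV2 ?posrE ?powR_gt0//.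
by rewrite ge0_ler_powR ?nnegrE ?subr_ge0// ltW.
Qed.

(* The choice [c = T] balances both terms. *)
Lemma young_powR_optimal (R : realType) (p X T : R) :
  1 <= p -> 0 <= T ->
  (forall c, 0 < c -> X <= c + c `^ (1 - p) * T `^ p) -> X <= 2 * T.
Proof.
move=> p1; rewrite le_eqVlt => /predU1P[<- XT|T0 /(_ _ T0)].
  rewrite mulr0; apply/ler_addgt0Pl => e e0; rewrite addr0.
  rewrite (le_trans (XT _ e0))// powR0 ?mulr0 ?addr0//.
  by rewrite gt_eqF// (lt_le_trans ltr01).
rewrite -powRD ?addrNK ?powRr1 ?(ltW T0)//; first by move=> /le_trans; apply; lra.
by rewrite (gt_eqF T0) implybT.
Qed.

Lemma ge0_integralX d1 d2 (T1 : measurableType d1) (T2 : measurableType d2)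
    (R : realType) (m1 : {sigma_finite_measure set T1 -> \bar R})
    (m2 : {sigma_finite_measure set T2 -> \bar R}) (A : set T1) (B : set T2)
    (f : T1 * T2 -> \bar R) :
  measurable A -> measurable B -> measurable_fun setT f ->
  (forall x, 0 <= f x)%E ->
  (\int[m1 \x m2]_(z in A `*` B) f z =
   \int[m1]_(x in A) \int[m2]_(y in B) f (x, y))%E.
Proof.
move=> mA mB mf f0; rewrite integral_mkcond fubini_tonelli1; last 2 first.
- apply/(measurable_restrictT _ _).1; first exact: measurableX.
  exact: measurable_funTS.
- exact: erestrict_ge0.
rewrite [RHS]integral_mkcond; apply: eq_integral => x _.
rewrite /fubini_F patchE; case: ifPn => xA.
  rewrite [RHS]integral_mkcond; apply: eq_integral => y _.
  by rewrite !patchE in_setX xA.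
rewrite integral0_eq// => y _; rewrite patchE in_setX (negbTE xA) //.
Qed.

Lemma measurable_fun_partial_integral d1 d2 (T1 : measurableType d1)
    (T2 : measurableType d2)
    (R : realType)
    (m2 : {sigma_finite_measure set T2 -> \bar R}) (B : set T2)
    (f : T1 * T2 -> \bar R) :
  measurable B -> measurable_fun setT f -> (forall x, 0 <= f x)%E ->
  measurable_fun setT (fun x => \int[m2]_(y in B) f (x, y))%E.
Proof.
move=> mB mf f0.
have mfr : measurable_fun setT (f \_ (setT `*` B)).
  apply/(measurable_restrictT _ _).1; first exact: measurableX.
  exact: measurable_funTS.
have := measurable_fun_fubini_tonelli_F (m2 := m2) _ mfr
  (erestrict_ge0 (fun x _ => f0 x)).
congr measurable_fun; apply/funext => x; rewrite /fubini_F [RHS]integral_mkcond.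
by apply: eq_integral => y _; rewrite !patchE in_setX in_setT.
Qed.

Section average.
Context {R : realType}.
Implicit Types (h g : R -> R) (a b c d : R).
Local Notation mu := (@lebesgue_measure R).

Lemma measurable_itvcc a b : measurable (`[a, b]%classic : set (measurableTypeR R)).
Proof. exact: measurable_itv. Qed.

Definition average h a b : R := (\int[mu]_(x in `[a, b]) h x) / (b - a).

Lemma mu_itvcc a b : a <= b -> mu `[a, b]%classic = (b - a)%:E.
Proof.
rewrite le_eqVlt => /predU1P[->|ab]; last first.
  by rewrite lebesgue_measure_itv/= lte_fin ab EFinB.
by rewrite lebesgue_measure_itv/= ltxx subrr.
Qed.

Lemma integrable_cst_itv a b c : mu.-integrable `[a, b] (EFin \o cst c).
Proof.
apply: measurable_bounded_integrable.
- exact: measurable_itv.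
- have [ab|ba] := leP a b; first by have := ltry (b - a); rewrite -(mu_itvcc ab).
  by rewrite set_itv_ge ?bnd_simp -?ltNge// measure0 ltry.
- exact: measurable_cst.
- exact: bounded_cst.
Qed.

Lemma Rintegral_cst_itv a b c : a <= b ->
  \int[mu]_(x in `[a, b]) c = c * (b - a).
Proof.
move=> ab; have := Rintegral_cst mu (measurable_itvcc a b) c.
by have /= -> := mu_itvcc ab.
Qed.

Lemma norm_averageB h a b c : a < b -> mu.-integrable `[a, b] (EFin \o h) ->
  `|average h a b - c| * (b - a) <= \int[mu]_(x in `[a, b]) `|h x - c|.
Proof.
move=> ab ih.
have ic : mu.-integrable `[a, b] (EFin \o cst c) by exact: integrable_cst_itv.
have ba : b - a != 0 by rewrite subr_eq0 gt_eqF.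
have ihc : mu.-integrable `[a, b] (EFin \o (fun x => h x - c)).
  have := integrableB (measurable_itvcc a b) ih ic.
  by apply: eq_integrable => // x _ /=; rewrite EFinB.
have <- : `|\int[mu]_(x in `[a, b]) (h x - c)| = `|average h a b - c| * (b - a).
  rewrite -{1}(gtr0_norm (_ : 0 < b - a)) ?subr_gt0// -normrM.
  by rewrite mulrBl /average divfK// -(Rintegral_cst_itv _ (ltW ab))
    (RintegralB (measurable_itvcc a b) ih ic).
exact: le_normr_Rintegral (measurable_itvcc a b) ihc.
Qed.

Lemma average_close h a b c e : a < b -> mu.-integrable `[a, b] (EFin \o h) ->
  {in `[a, b], forall x, `|h x - c| <= e} -> `|average h a b - c| <= e.
Proof.
move=> ab ih he.
have ba : 0 < b - a by rewrite subr_gt0.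
have ic r : mu.-integrable `[a, b] (EFin \o cst r) by exact: integrable_cst_itv.
have ihc : mu.-integrable `[a, b] (EFin \o (fun x => h x - c)).
  have := integrableB (measurable_itvcc a b) ih (ic c).
  by apply: eq_integrable => // x _ /=; rewrite EFinB.
rewrite -(ler_pM2r ba) (le_trans (norm_averageB c ab ih))//.
rewrite -(Rintegral_cst_itv _ (ltW ab)).
apply: (le_Rintegral (measurable_itvcc a b)).
- exact: integrable_norm.
- exact: ic.
- by move=> x xab; apply: he.
Qed.

End average.

Section average_energy.
Context {R : realType}.
Implicit Types (h g : R -> R) (a b c d delta p : R).
Local Notation mu := (@lebesgue_measure R).

Lemma EFin_Rintegral_itv f a b : mu.-integrable `[a, b] (EFin \o f) ->
  (\int[mu]_(x in `[a, b]) f x)%:E = (\int[mu]_(x in `[a, b]) (f x)%:E)%E.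
Proof.
move=> i; rewrite /Rintegral fineK//.
exact: (integrable_fin_num (measurable_itvcc a b) i).
Qed.

Lemma integrableB_cst h a b c : mu.-integrable `[a, b] (EFin \o h) ->
  mu.-integrable `[a, b] (EFin \o (fun x => h x - c)).
Proof.
move=> ih.
have := integrableB (measurable_itvcc a b) ih (integrable_cst_itv a b c).
by apply: eq_integrable => // x _ /=; rewrite EFinB.
Qed.

Lemma partial_energy h a b delta p c0 u :
  1 <= p -> 0 < delta -> measurable_fun setT h ->
  mu.-integrable `[a, b] (EFin \o h) -> a < b -> 0 < c0 ->
  u \in `[a, b] ->
  ((`|average h a b - h u| * (b - a))%:E <= (c0 * (b - a))%:E +
    (c0 `^ (1 - p) * (b - a) `^ (1 + delta * p))%:E *
    \int[mu]_(v in `[a, b]) (slobodeckij_kernel delta p h (u, v))%:E)%E.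
Proof.
move=> p1 delta0 mh ih ab c00 uab.
set M := c0 `^ (1 - p) * (b - a) `^ (1 + delta * p).
have M0 : 0 <= M by rewrite mulr_ge0 ?powR_ge0.
have mk : measurable_fun `[a, b] (fun v => (slobodeckij_kernel delta p h (u, v))%:E).
  have mk := measurable_slobodeckij_kernel delta p mh.
  apply/measurable_EFinP; apply: measurable_funTS.
  exact: (measurableT_comp mk (pair1_measurable u)).
have k0 v : (0 <= (slobodeckij_kernel delta p h (u, v))%:E)%E.
  by rewrite (lee_fin 0) slobodeckij_kernel_ge0.
rewrite -ge0_integralZl//.
rewrite -Rintegral_cst_itv ?(ltW ab)// EFin_Rintegral_itv; last first.
  exact: integrable_cst_itv.
rewrite -ge0_integralD//;
  [|by move=> x _; rewrite lee_fin ltW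
   |by move=> x _; rewrite mule_ge0// lee_fin
   |exact: measurable_funeM].
apply: (@le_trans _ _ (\int[mu]_(x in `[a, b]) `|h x - h u|)%:E).
  by rewrite lee_fin; exact: norm_averageB.
rewrite EFin_Rintegral_itv; last first.
  by apply: integrable_norm; exact: integrableB_cst.
apply: ge0_le_integral => //=.
- apply/measurable_EFinP; apply: measurableT_comp => //.
  by apply: measurable_funB => //; exact: measurable_funTS.
- by apply: emeasurable_funD => //; exact: measurable_funeM.
move=> v vab; rewrite -EFinM -EFinD lee_fin.
rewrite (le_trans (young_powR p1 (normr_ge0 _) c00))// lerD2l /M -mulrA.
rewrite ler_wpM2l ?powR_ge0// /slobodeckij_kernel /=.
have [->|vu] := eqVneq v u.
  by rewrite subrr normr0 powR0 ?mul0r ?mulr0// gt_eqF// (lt_le_trans ltr01).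
have vu0 : 0 < `|v - u| by rewrite normr_gt0 subr_eq0.
rewrite mulrCA ler_peMr ?powR_ge0// ler_pdivlMr ?powR_gt0// mul1r.
have dp : 0 <= delta * p by rewrite mulr_ge0 ?(ltW delta0)// (le_trans ler01).
have L0 : 0 < b - a by rewrite subr_gt0.
rewrite ge0_ler_powR ?nnegrE ?(ltW L0) ?addr_ge0//.
move: uab vab; rewrite !in_itv/= => /andP[? ?] /andP[? ?].
by rewrite ler_norml; apply/andP; split; lra.
Qed.

Lemma averageB_energy h a b c d delta p :
  1 <= p -> 0 < delta -> measurable_fun setT h ->
  mu.-integrable `[a, b] (EFin \o h) -> (energy delta p h a b < +oo)%E ->
  a <= c -> c < d -> d <= b ->
  `|average h c d - average h a b| <= 2 * (((b - a) / (d - c)) `^ p^-1 *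
    (b - a) `^ (delta - p^-1) * fine (energy delta p h a b) `^ p^-1).
Proof.
move=> p1 delta0 mh ih Eoo ac cd db.
have ab : a < b by lra.
have p0 : 0 < p by rewrite (lt_le_trans ltr01).
have L0 : 0 < b - a by rewrite subr_gt0.
have l0 : 0 < d - c by rewrite subr_gt0.
set E := fine _.
have E0 : 0 <= E by rewrite fine_ge0// energy_ge0.
apply: (young_powR_optimal p1); first by rewrite !mulr_ge0 ?powR_ge0.
move=> c0 c00.
set m := average h a b.
set k := slobodeckij_kernel delta p h.
have ihcd : mu.-integrable `[c, d] (EFin \o h).
  apply: integrableS ih; [exact: measurable_itvcc|exact: measurable_itvcc|].
  by apply: subset_itv; rewrite bnd_simp.
have -> : (((b - a) / (d - c)) `^ p^-1 * (b - a) `^ (delta - p^-1) *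
    E `^ p^-1) `^ p = (b - a) `^ (1 + delta * p) * E / ((b - a) * (d - c)).
  have powRM3 x y z : 0 <= x -> 0 <= y -> 0 <= z ->
      (x * y * z) `^ p = x `^ p * y `^ p * z `^ p.
    by move=> x0 y0 z0; rewrite powRM ?mulr_ge0// powRM.
  rewrite powRM3 ?powR_ge0// -!powRrM.
  rewrite mulVf ?gt_eqF// !powRr1 ?divr_ge0 ?(ltW L0) ?(ltW l0)//.
  rewrite (mulrBl p delta) mulVf ?gt_eqF//.
  have nz r : r ==> (b - a != 0) by rewrite (gt_eqF L0) implybT.
  rewrite powRB// powRD// powRr1 ?(ltW L0)//.
  by field; rewrite !gt_eqF.
set M := c0 `^ (1 - p) * (b - a) `^ (1 + delta * p).
rewrite -(ler_pM2r (mulr_gt0 L0 l0)).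
rewrite [leRHS](_ : _ = c0 * ((b - a) * (d - c)) + M * E); last first.
  by rewrite /M; field; rewrite !gt_eqF.
have M0 : 0 <= M by rewrite mulr_ge0 ?powR_ge0.
have mk : measurable_fun setT (EFin \o k).
  by apply/measurable_EFinP; exact: measurable_slobodeckij_kernel.
have k0 z : (0 <= (k z)%:E)%E by rewrite (lee_fin 0) slobodeckij_kernel_ge0.
pose K u := (\int[mu]_(v in `[a, b]) (k (u, v))%:E)%E.
have mK : measurable_fun setT K.
  apply: (@measurable_fun_partial_integral _ _ _ _ _ mu `[a, b]%classic
    (EFin \o k)); [exact: measurable_itvcc|exact: mk|].
  exact: k0.
have K0 u : (0 <= K u)%E by exact: integral_ge0.
have EK : (\int[mu]_(u in `[a, b]) K u)%E = E%:E.
  rewrite /E fineK; last by rewrite ge0_fin_numE// energy_ge0.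
  rewrite /energy.
  apply/esym; apply: (@ge0_integralX _ _ _ _ _ mu mu `[a, b]%classic
    `[a, b]%classic (EFin \o k)); [exact: measurable_itvcc|exact: measurable_itvcc| |].
    exact: mk.
  exact: k0.
apply: (@le_trans _ _ ((b - a) * \int[mu]_(x in `[c, d]) `|h x - m|)).
  by rewrite mulrCA ler_pM2l//; exact: norm_averageB.
have im : mu.-integrable `[c, d] (EFin \o (fun x => `|h x - m|)).
  by apply: integrable_norm; exact: integrableB_cst.
rewrite -(RintegralZl (b - a) (measurable_itvcc c d) im) -lee_fin.
rewrite EFin_Rintegral_itv; last first.
  have := integrableZl (measurable_itvcc c d) (b - a) im.
  by apply: eq_integrable.
rewrite EFinD (EFinM M) -EK -ge0_integralZl//; last exact: measurable_funTS.
apply: (@le_trans _ _ (\int[mu]_(x in `[c, d]) ((c0 * (b - a))%:E + M%:E * K x))%E).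
  apply: ge0_le_integral => //=.
  - by move=> x _; rewrite lee_fin mulr_ge0 ?(ltW L0).
  - apply/measurable_EFinP; apply: measurable_funM => //.
    apply: measurableT_comp => //.
    by apply: measurable_funB => //; exact: measurable_funTS.
  - apply: emeasurable_funD => //; apply: measurable_funeM.
    exact: measurable_funTS.
  move=> u ucd; rewrite mulrC distrC.
  apply: partial_energy => //.
  by move: ucd; rewrite !in_itv/= => /andP[? ?]; apply/andP; split; lra.
rewrite ge0_integralD//; first last.
- by apply: measurable_funeM; exact: measurable_funTS.
- by move=> x _; rewrite mule_ge0// lee_fin.
- by move=> x _; rewrite lee_fin mulr_ge0 ?ltW.
apply: leeD.
  rewrite -EFin_Rintegral_itv; last exact: integrable_cst_itv.
  by rewrite Rintegral_cst_itv ?(ltW cd)// lee_fin mulrA.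
apply: ge0_subset_integral; [exact: measurable_itvcc|exact: measurable_itvcc| | |].
- by apply: measurable_funeM; exact: measurable_funTS.
- by move=> x _; rewrite mule_ge0// lee_fin.
- by apply: subset_itv; rewrite bnd_simp.
Qed.

End average_energy.

Lemma geometric_cvg (R : realType) (u : R^nat) (D r : R) :
  0 <= r -> r < 1 -> (forall n, `|u n.+1 - u n| <= D * r ^+ n) ->
  cvgn u /\ `|limn u - u 0%N| <= D / (1 - r).
Proof.
move=> r0 r1 uD.
have D0 : 0 <= D by have := le_trans (normr_ge0 _) (uD 0%N); rewrite mulr1.
have cu : cvgn (series (telescope u)).
  apply: (@normed_cvg _ R^o); apply: (series_le_cvg (v_ := geometric D r)) => //.
  - by move=> n; exact: normr_ge0.
  - by move=> n; rewrite /= mulr_ge0 ?exprn_ge0.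
  - by apply: is_cvg_geometric_series; rewrite ger0_norm.
have {}cu : cvgn u.
  rewrite (_ : u = (fun n => u 0%N + series (telescope u) n)).
    by apply: is_cvgD => //; exact: is_cvg_cst.
  by apply/funext => n; rewrite -eq_sum_telescope.
split => //.
have cn : (fun n => `|u n - u 0%N|) @ \oo --> `|limn u - u 0%N|.
  by apply: cvg_norm; apply: cvgB => //; exact: cvg_cst.
rewrite -(cvg_lim _ cn)//; apply: limr_le; first by apply/cvg_ex; eexists; exact: cn.
apply: nearW => n; rewrite (eq_sum_telescope u n) addrAC subrr add0r.
rewrite seriesEnat/=; apply: (le_trans (ler_norm_sum _ _ _)).
apply: (@le_trans _ _ (series (geometric D r) n)).
  by rewrite seriesEnat/=; apply: ler_sum => i _; exact: uD.
rewrite geometric_seriesE ?lt_eqF//= ler_pM2r ?invr_gt0 ?subr_gt0//.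
by rewrite ler_piMr// gerBl exprn_ge0.
Qed.

Section representative.
Context {R : realType}.
Local Notation mu := (@lebesgue_measure R).
Implicit Types (h : R -> R) (a b x y : R).

Definition shrunk_average h a b x (n : nat) : R :=
  average h (x - (x - a) * 2^-1 ^+ n) (x + (b - x) * 2^-1 ^+ n).

Definition representative h x : R := limn (shrunk_average h 0 1 x).

Lemma shrink_itv a b x r : a <= x <= b -> 0 <= r <= 1 ->
  [/\ a <= x - (x - a) * r, x - (x - a) * r <= x,
      x <= x + (b - x) * r & x + (b - x) * r <= b].
Proof.
move=> /andP[ax xb] /andP[r0 r1].
have xa0 : 0 <= x - a by rewrite subr_ge0.
have bx0 : 0 <= b - x by rewrite subr_ge0.
have := mulr_ge0 xa0 r0; have := mulr_ge0 bx0 r0.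
have := ler_piMr xa0 r1; have := ler_piMr bx0 r1.
set u := (b - x) * r; set v := (x - a) * r; split; lra.
Qed.

Lemma shrink_itv_lt a b x r : a < b -> 0 < r ->
  x - (x - a) * r < x + (b - x) * r.
Proof.
move=> ab r0; rewrite -subr_gt0 (_ : _ - _ = (b - a) * r); last by ring.
by rewrite mulr_gt0// subr_gt0.
Qed.

Lemma half_expr_bounds (n : nat) : 0 < 2^-1 ^+ n :> R /\ 2^-1 ^+ n <= 1 :> R.
Proof. by split; [rewrite exprn_gt0|rewrite exprn_ile1//; lra]. Qed.

Context (delta p : R) (h : R -> R).
Context (p1 : 1 <= p) (delta0 : 0 < delta) (alpha0 : 0 < delta - p^-1).
Context (mh : measurable_fun setT h).
Context (ih : mu.-integrable `[0, 1] (EFin \o h)).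
Context (Eoo : (energy delta p h 0 1 < +oo)%E).

Let alpha := delta - p^-1.
Let S a b := fine (energy delta p h a b) `^ p^-1.

Let p0 : 0 < p. Proof. by rewrite (lt_le_trans ltr01). Qed.

Lemma energy_lty a b : 0 <= a -> b <= 1 -> (energy delta p h a b < +oo)%E.
Proof. by move=> a0 b1; apply: le_lt_trans Eoo; exact: le_energy. Qed.

Lemma energy_fin_num a b : 0 <= a -> b <= 1 -> energy delta p h a b \is a fin_num.
Proof. by move=> a0 b1; rewrite ge0_fin_numE ?energy_ge0// energy_lty. Qed.

Lemma energy_root_le a b c d : 0 <= a -> b <= 1 -> a <= c -> d <= b -> S c d <= S a b.
Proof.
move=> a0 b1 ac db; rewrite ge0_ler_powR ?nnegrE ?fine_ge0 ?energy_ge0//.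
  by rewrite invr_ge0 ltW.
by apply: fine_le; [apply: energy_fin_num; lra|apply: energy_fin_num; lra|
  exact: le_energy].
Qed.

Lemma integrable_subitv a b : 0 <= a -> b <= 1 ->
  mu.-integrable `[a, b] (EFin \o h).
Proof.
move=> a0 b1.
apply: integrableS ih; [exact: measurable_itvcc|exact: measurable_itvcc|].
by apply: subset_itv; rewrite bnd_simp.
Qed.

Lemma averageB_le a b c d : 0 <= a -> b <= 1 -> a <= c -> c < d -> d <= b ->
  `|average h c d - average h a b| <=
  2 * (((b - a) / (d - c)) `^ p^-1 * (b - a) `^ alpha * S a b).
Proof.
move=> a0 b1 ac cd db; apply: averageB_energy => //.
- exact: integrable_subitv.
- exact: energy_lty.
Qed.

Let rho : R := 2^-1 `^ alpha.

Let rho0 : 0 < rho. Proof. by rewrite powR_gt0. Qed.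

Let rho1 : rho < 1.
Proof.
have <- : 1 `^ alpha = 1 :> R by rewrite powR1.
by rewrite gt0_ltr_powR ?nnegrE//; lra.
Qed.

Let half_powR n : (2^-1 ^+ n) `^ alpha = rho ^+ n.
Proof. by rewrite -(@powR_mulrn _ 2^-1)// powRAC powR_mulrn ?powR_ge0. Qed.

Definition campanato_cst : R := 2 * 2 `^ p^-1 / (1 - rho).

Lemma campanato_cst_ge0 : 0 <= campanato_cst.
Proof. by rewrite divr_ge0 ?mulr_ge0 ?powR_ge0// subr_ge0 ltW. Qed.

Lemma shrunk_average_step a b x n : 0 <= a -> a < b -> b <= 1 -> a <= x <= b ->
  `|shrunk_average h a b x n.+1 - shrunk_average h a b x n| <=
  2 * 2 `^ p^-1 * (b - a) `^ alpha * S a b * rho ^+ n.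
Proof.
move=> a0 ab b1 axb.
have [r0 r1] := half_expr_bounds n.
rewrite /shrunk_average exprS; move: r0 r1 (half_powR n).
set r := 2^-1 ^+ n => r0 r1 rE.
have r01 : 0 <= r <= 1 by rewrite r1 ltW.
have h01 : 0 <= (2^-1 : R) <= 1 by apply/andP; split; lra.
have [lo0 lo1 hi0 hi1] := shrink_itv axb r01.
have lohi : x - (x - a) * r <= x <= x + (b - x) * r by rewrite lo1.
have [l0 l1 u0 u1] := shrink_itv lohi h01.
apply: le_trans (averageB_le _ _ _ _ _) _.
- exact: le_trans lo0.
- exact: le_trans b1.
- by apply: (le_trans l0); rewrite le_eqVlt; apply/orP; left; apply/eqP; ring.
- by apply: shrink_itv_lt => //; rewrite mulr_gt0.
- by apply: le_trans u1; rewrite le_eqVlt; apply/orP; left; apply/eqP; ring.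
rewrite (_ : _ + _ - _ = (b - a) * r); last by ring.
rewrite (_ : x + _ - _ = (b - a) * (2^-1 * r)); last by ring.
rewrite (_ : _ / _ = 2); last by field; rewrite !gt_eqF// subr_gt0.
rewrite powRM ?(ltW r0) ?subr_ge0 ?(ltW ab)// rE -!mulrA ler_pM2l//.
apply: ler_wpM2l; first exact: powR_ge0.
apply: ler_wpM2l; first exact: powR_ge0.
rewrite [leRHS]mulrC; apply: ler_wpM2l; first exact: exprn_ge0 (ltW rho0).
by apply: energy_root_le => //; lra.
Qed.

Lemma shrunk_average_near a b x n : 0 <= a -> a < b -> b <= 1 -> a <= x <= b ->
  `|shrunk_average h a b x n - shrunk_average h 0 1 x n| <=
  2 * ((b - a)^-1 `^ p^-1 * S 0 1) * rho ^+ n.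
Proof.
move=> a0 ab b1 axb.
have [r0 r1] := half_expr_bounds n.
rewrite /shrunk_average; move: r0 r1 (half_powR n).
set r := 2^-1 ^+ n => r0 r1 rE.
have r01 : 0 <= r <= 1 by rewrite r1 ltW.
have x01 : 0 <= x <= 1 by move: axb => /andP[? ?]; apply/andP; split; lra.
have [lo0 lo1 hi0 hi1] := shrink_itv x01 r01.
apply: le_trans (averageB_le _ _ _ _ _) _ => //.
- by rewrite lerD2l lerN2 ler_wpM2r ?(ltW r0)// lerD2l lerN2.
- exact: shrink_itv_lt.
- by rewrite lerD2l ler_wpM2r ?(ltW r0)// lerD2r.
rewrite (_ : _ + _ - _ = r); last by ring.
rewrite (_ : x + _ - _ = (b - a) * r); last by ring.
rewrite (_ : _ / _ = (b - a)^-1); last by field; rewrite !gt_eqF// subr_gt0.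
rewrite rE -!mulrA ler_pM2l//; apply: ler_wpM2l; first exact: powR_ge0.
rewrite [leRHS]mulrC; apply: ler_wpM2l; first exact: exprn_ge0 (ltW rho0).
by apply: energy_root_le.
Qed.

Lemma cvg_shrunk_average a b x : 0 <= a -> a < b -> b <= 1 -> a <= x <= b ->
  shrunk_average h a b x @ \oo --> representative h x.
Proof.
move=> a0 ab b1 axb.
have x01 : 0 <= x <= 1 by move: axb => /andP[? ?]; apply/andP; split; lra.
have [c01 _] := geometric_cvg (ltW rho0) rho1
  (fun n => shrunk_average_step n (lexx 0) ltr01 (lexx 1) x01).
have e0 : (fun n => shrunk_average h a b x n - shrunk_average h 0 1 x n)
    @ \oo --> (0 : R).
  apply/norm_cvg0P.
  apply: (@squeeze_cvgr _ _ _ _ (cst 0)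
    (geometric (2 * ((b - a)^-1 `^ p^-1 * S 0 1)) rho)).
  - by apply: nearW => n; rewrite normr_ge0/= shrunk_average_near.
  - exact: cvg_cst.
  - by apply: cvg_geometric; rewrite gtr0_norm.
rewrite -[representative h x]add0r (_ : shrunk_average h a b x = (fun n =>
    shrunk_average h a b x n - shrunk_average h 0 1 x n + shrunk_average h 0 1 x n)).
  exact: cvgD e0 c01.
by apply/funext => n; rewrite subrK.
Qed.

Lemma representative_average a b x : 0 <= a -> a < b -> b <= 1 -> a <= x <= b ->
  `|representative h x - average h a b| <=
  campanato_cst * (b - a) `^ alpha * S a b.
Proof.
move=> a0 ab b1 axb.
have [_] := geometric_cvg (ltW rho0) rho1
  (fun n => shrunk_average_step n a0 ab b1 axb).
rewrite (cvg_lim _ (cvg_shrunk_average a0 ab b1 axb))//.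
rewrite /shrunk_average expr0 !mulr1 subKr subrKC => /le_trans; apply.
rewrite /campanato_cst le_eqVlt; apply/orP; left; apply/eqP; field.
by rewrite gt_eqF// subr_gt0.
Qed.

Lemma representative_holder x y : 0 <= x -> x <= y -> y <= 1 ->
  `|representative h y - representative h x| <=
  2 * campanato_cst * (y - x) `^ alpha * S x y.
Proof.
move=> x0; rewrite le_eqVlt => /predU1P[->|xy] y1.
  rewrite subrr normr0 mulr_ge0 ?powR_ge0// mulr_ge0 ?powR_ge0//.
  by rewrite mulr_ge0// campanato_cst_ge0.
rewrite -(subrKA (average h x y)) (le_trans (ler_normD _ _))//.
rewrite (distrC (average _ _ _)) -!mulrA mulr_natl mulr2n !mulrA.
by apply: lerD; apply: representative_average => //; rewrite lexx (ltW xy).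
Qed.

End representative.

Section continuous_representatives.
Context {R : realType}.
Local Notation mu := (@lebesgue_measure R).
Implicit Types (h g : R -> R) (a b x y : R).

Lemma average_ae_eq h g a b : measurable_fun `[a, b] h ->
  measurable_fun `[a, b] g -> ae_eq mu `[a, b]%classic h g ->
  average h a b = average g a b.
Proof.
move=> mh mg hg; rewrite /average /Rintegral; congr (fine _ / _).
apply: ae_eq_integral.
- exact: measurable_itvcc.
- exact/measurable_EFinP.
- exact/measurable_EFinP.
- exact: ae_eq_comp hg.
Qed.

Lemma shrunk_averages_continuous g x : 0 <= x <= 1 ->
  {within `[0, 1], continuous g} -> shrunk_average g 0 1 x @ \oo --> g x.
Proof.
move=> x01 cg.
have /subspace_continuousP/(_ x) := cg.
rewrite /= in_itv/= => /(_ x01) cgx.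
apply/cvgrPdistC_le => e e0.
have /cvgrPdistC_le/(_ _ e0) := cgx.
rewrite near_withinE => /nbhs_ballP[d /= d0 dP].
have : (fun n => 2^-1 ^+ n : R) @ \oo --> (0 : R).
  by apply: cvg_expr; rewrite ger0_norm; lra.
move=> /cvgr0_norm_lt/(_ _ d0); apply: filterS => n.
rewrite ger0_norm; last by rewrite exprn_ge0.
have [r0 r1] := @half_expr_bounds R n.
rewrite /shrunk_average; move: r0 r1; set r := 2^-1 ^+ n => r0 r1 rd.
have r01 : 0 <= r <= 1 by rewrite r1 ltW.
have [lo0 lo1 hi0 hi1] := shrink_itv x01 r01.
apply: average_close.
- exact: shrink_itv_lt.
- apply: (@continuous_compact_integrable _ g); first exact: segment_compact.
  by apply: continuous_subspaceW cg; apply: subset_itv; rewrite bnd_simp.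
move=> y; rewrite in_itv/= => /andP[ly yu].
have [x0 x1] := andP x01.
have xr : (x - 0) * r <= r by rewrite subr0 ler_piMl// ltW.
have xr1 : (1 - x) * r <= r by rewrite ler_piMl ?(ltW r0)// gerBl.
apply: dP; rewrite /ball/=.
  by move: ly yu xr xr1; set u := _ * r; set v := (1 - x) * r => *;
    rewrite ltr_norml; apply/andP; split; lra.
by rewrite in_itv/= (le_trans lo0 ly) (le_trans yu hi1).
Qed.

Lemma representative_unique h g x : measurable_fun setT h -> 0 <= x <= 1 ->
  continuous_representative h g -> representative h x = g x.
Proof.
move=> mh x01 [cg hg].
rewrite -(cvg_lim _ (shrunk_averages_continuous x01 cg))//.
congr (limn _); apply/funext => n.
have [r0 r1] := @half_expr_bounds R n.
rewrite /shrunk_average; move: r0 r1; set r := 2^-1 ^+ n => r0 r1.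
have r01 : 0 <= r <= 1 by rewrite r1 ltW.
have [lo0 lo1 hi0 hi1] := shrink_itv x01 r01.
have sub : `[x - (x - 0) * r, x + (1 - x) * r] `<=` `[0, 1].
  by apply: subset_itv; rewrite bnd_simp.
apply: average_ae_eq.
- exact: measurable_funTS.
- apply: subspace_continuous_measurable_fun; first exact: measurable_itv.
  exact: continuous_subspaceW cg.
- by apply: filterS hg => y + /sub; apply.
Qed.

Lemma representative_ae_eq h : mu.-integrable setT (EFin \o h) ->
  {ae mu, forall x, h x = representative h x}.
Proof.
move=> ih.
have lh : locally_integrable setT h.
  by apply: open_integrable_locally => //; exact: openT.
pose E x (n : nat) : set R :=
  `[x - (x - 0) * 2^-1 ^+ n, x + (1 - x) * 2^-1 ^+ n]%classic.
have r0 n : 0 < 2^-1 ^+ n :> R by rewrite exprn_gt0.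
have muE x n : mu (E x n) = (2^-1 ^+ n)%:E.
  rewrite mu_itvcc; first by congr EFin; ring.
  by apply/ltW/shrink_itv_lt.
have nE x : nicely_shrinking x (E x).
  split; first by move=> n; exact: measurable_itv.
  have C0 : 0 < `|x| + 2 by have := normr_ge0 x; lra.
  exists ((`|x| + 2) * 2, fun n => PosNum (mulr_gt0 C0 (r0 n))); split => /=.
  - by rewrite mulr_gt0.
  - rewrite -(mulr0 (`|x| + 2)); apply: cvgMl_tmp.
    by apply: cvg_expr; rewrite ger0_norm; lra.
  - move=> n y; rewrite /E /= in_itv/= /ball/= => /andP[l u].
    have := r0 n; move: l u; set r := 2^-1 ^+ n => l u r_gt0.
    have xr : `|(x - 0) * r| <= `|x| * r.
      by rewrite subr0 normrM (gtr0_norm r_gt0).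
    have xr1 : `|(1 - x) * r| <= `|x| * r + r.
      rewrite normrM (gtr0_norm r_gt0) (_ : _ + r = (1 + `|x|) * r); last by ring.
      rewrite ler_wpM2r ?(ltW r_gt0)// -[X in _ <= X + _]normr1.
      exact: ler_normB.
    rewrite mulrDl; move: l u xr xr1; rewrite !ler_norml.
    set u := _ * r; set v := (1 - x) * r; set w := `|x| * r.
    move=> l1 u1 /andP[? ?] /andP[? ?].
    by rewrite ltr_norml; apply/andP; split; lra.
  - move=> n; rewrite lebesgue_measure_ball; last by rewrite mulr_ge0 ?ltW.
    rewrite muE -EFinM lee_fin le_eqVlt; apply/orP; left; apply/eqP; ring.
have := lebesgue_differentiation lh.
apply: (@filterS _ _ (ae_filter_ringOfSetsType mu)) => x hx.
have := nice_lebesgue_differentiation nE lh hx.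
move=> /fine_cvgP[_ /= cx]; rewrite -(cvg_lim _ cx)//.
congr (limn _); apply/funext => n /=.
rewrite muE inver gt_eqF ?r0// /shrunk_average /average.
rewrite fineM//=; last first.
  apply: integrable_fin_num; first exact: measurable_itvcc.
  by apply: integrableS ih; [exact: measurableT|exact: measurable_itvcc|].
by rewrite mulrC; congr (_ / _); ring.
Qed.

End continuous_representatives.

Lemma ge0_integral_lty_comb d (T : measurableType d) (R : realType)
    (mu : {measure set T -> \bar R}) (D : set T) (f f1 f2 : T -> R) (a b : R) :
  measurable D -> measurable_fun setT f -> measurable_fun setT f1 ->
  measurable_fun setT f2 -> (forall x, 0 <= f x) -> (forall x, 0 <= f1 x) ->
  (forall x, 0 <= f2 x) -> 0 <= a -> 0 <= b ->
  (forall x, f x <= a * f1 x + b * f2 x) ->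
  (\int[mu]_(x in D) (f1 x)%:E < +oo)%E ->
  (\int[mu]_(x in D) (f2 x)%:E < +oo)%E ->
  (\int[mu]_(x in D) (f x)%:E < +oo)%E.
Proof.
move=> mD mf mf1 mf2 f0 f10 f20 a0 b0 fle i1 i2.
have mE g : measurable_fun setT g -> measurable_fun D (EFin \o g).
  by move=> mg; apply/measurable_EFinP; exact: measurable_funTS.
apply: (@le_lt_trans _ _
    (\int[mu]_(x in D) (a%:E * (f1 x)%:E + b%:E * (f2 x)%:E))%E).
  apply: ge0_le_integral => //.
  - by move=> x _; rewrite lee_fin.
  - exact: mE.
  - by apply: emeasurable_funD; apply: measurable_funeM; exact: mE.
  - by move=> x _; rewrite -!EFinM -EFinD lee_fin.
rewrite ge0_integralD//; first last.
- by apply: measurable_funeM; exact: mE.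
- by move=> x _; rewrite -EFinM lee_fin mulr_ge0.
- by apply: measurable_funeM; exact: mE.
- by move=> x _; rewrite -EFinM lee_fin mulr_ge0.
rewrite !ge0_integralZl//; first last.
- by move=> x _; rewrite lee_fin.
- exact: mE.
- by move=> x _; rewrite lee_fin.
- exact: mE.
by rewrite lte_add_pinfty// lte_mul_pinfty// lee_fin.
Qed.

Lemma powR_normD_le (R : realType) (p x y : R) : 1 <= p ->
  `|x + y| `^ p <= 2 `^ p * (`|x| `^ p + `|y| `^ p).
Proof.
move=> p1; have p0 : 0 <= p by rewrite (le_trans ler01).
pose m := Num.max `|x| `|y|.
have m0 : 0 <= m by rewrite le_max normr_ge0.
apply: (@le_trans _ _ ((2 * m) `^ p)).
  rewrite ge0_ler_powR ?nnegrE ?mulr_ge0// (le_trans (ler_normD _ _))//.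
  by rewrite mulr_natl mulr2n lerD// le_max lexx ?orbT.
rewrite powRM// ler_wpM2l ?powR_ge0// /m maxEle; case: ifP => _.
  by rewrite lerDr powR_ge0.
by rewrite lerDl powR_ge0.
Qed.

Section sobolev_functions.
Context {R : realType}.
Local Notation mu := (@lebesgue_measure R).
Local Notation I01 := (`[0%R, 1%R]%classic : set R).
Implicit Types (h : R -> R) (delta p s t a b : R).

Lemma measurable_patch_itv h a b : measurable_fun `[a, b] h ->
  measurable_fun setT (h \_ `[a, b]).
Proof.
move=> mh; apply/(measurable_restrictT _ _).1 => //; exact: measurable_itv.
Qed.

Lemma slobodeckij_patch delta p h s t : 0 <= s -> t <= 1 ->
  slobodeckij delta p h s t = slobodeckij delta p (h \_ I01) s t.
Proof.
move=> s0 t1; rewrite !slobodeckijE.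
suff -> : energy delta p h s t = energy delta p (h \_ I01) s t by [].
apply: eq_energy => x.
rewrite in_itv/= => /andP[sx xt]; rewrite patchE mem_set//= in_itv/=.
by rewrite (le_trans s0 sx) (le_trans xt t1).
Qed.

Lemma slobodeckij_lty delta p h s t : 0 < p ->
  (slobodeckij delta p h s t < +oo)%E = (energy delta p h s t < +oo)%E.
Proof.
move=> p0; apply/idP/idP => [|/poweR_lty]; last by apply.
by apply: lty_poweRy; rewrite invr_neq0// gt_eqF.
Qed.

Lemma LnormE p (f : R -> R) :
  'N[mu]_(p%:E)[EFin \o f]%E = ((\int[mu]_x (`|f x| `^ p)%:E) `^ p^-1)%E.
Proof. by rewrite unlock. Qed.

Lemma Lnorm_lty p (f : R -> R) : 0 < p ->
  ('N[mu]_(p%:E)[EFin \o f] < +oo)%E = (\int[mu]_x (`|f x| `^ p)%:E < +oo)%E.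
Proof.
move=> p0; rewrite LnormE; apply/idP/idP => [|/poweR_lty]; last by apply.
by apply: lty_poweRy; rewrite invr_neq0// gt_eqF.
Qed.

Lemma sobolevP delta p h : 0 < p -> sobolev delta p h <->
  [/\ measurable_fun I01 h, measurable_fun setT (h \_ I01),
    (\int[mu]_x (`|(h \_ I01) x| `^ p)%:E < +oo)%E &
    (energy delta p (h \_ I01) 0 1 < +oo)%E].
Proof.
move=> p0; rewrite /sobolev/= /sobolev_norm (@slobodeckij_patch _ _ _ 0 1)//.
split.
  move=> [mh noo]; split => //; first exact: measurable_patch_itv.
    rewrite -Lnorm_lty//; apply: le_lt_trans noo; rewrite leeDl//.
    exact: poweR_ge0.
  rewrite -slobodeckij_lty//; apply: le_lt_trans noo; rewrite leeDr//.
  exact: Lnorm_ge0.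
move=> [mh mH Noo Eoo]; split => //.
by rewrite lte_add_pinfty// ?Lnorm_lty// slobodeckij_lty.
Qed.

Lemma integral_norm_Lnorm p (f : R -> R) a : 1 <= p ->
  measurable_fun setT f -> (\int[mu]_x (`|f x| `^ p)%:E < +oo)%E ->
  (\int[mu]_(x in `[a, (a + 1)%R]) `|f x|%:E <=
    (2 * fine ('N[mu]_(p%:E)[EFin \o f])%E)%:E)%E.
Proof.
move=> p1 mf foo.
have p0 : 0 < p by rewrite (lt_le_trans ltr01).
have mfp : measurable_fun setT (fun x => `|f x| `^ p).
  by apply: (measurableT_comp (measurable_powR _)); exact: measurableT_comp.
have mfa : measurable_fun `[a, (a + 1)%R] (fun x => (`|f x| `^ p)%:E).
  by apply/measurable_EFinP; exact: measurable_funTS.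
set Ip := (\int[mu]_x (`|f x| `^ p)%:E)%E in foo *.
have Ip0 : (0 <= Ip)%E by apply: integral_ge0 => x _; rewrite lee_fin powR_ge0.
have NE : fine ('N[mu]_(p%:E)[EFin \o f])%E `^ p = fine Ip.
  by rewrite LnormE fine_poweR -powRrM mulVf ?gt_eqF// powRr1// fine_ge0.
set N := fine _ in NE *.
have N0 : 0 <= N by rewrite fine_ge0// Lnorm_ge0.
have a1 : a <= a + 1 by rewrite lerDl.
have bound c : 0 < c -> (\int[mu]_(x in `[a, (a + 1)%R]) `|f x|%:E <=
    (c + c `^ (1 - p) * N `^ p)%:E)%E.
  move=> c0; rewrite EFinD EFinM NE fineK ?ge0_fin_numE//.
  apply: (@le_trans _ _ (\int[mu]_(x in `[a, (a + 1)%R])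
      (c%:E + (c `^ (1 - p))%:E * (`|f x| `^ p)%:E))%E).
    apply: ge0_le_integral => //.
    - apply/measurable_EFinP; apply: measurableT_comp => //.
      exact: measurable_funTS.
    - by apply: emeasurable_funD => //; exact: measurable_funeM.
    - by move=> x _; rewrite -EFinM -EFinD lee_fin young_powR.
  rewrite ge0_integralD//; first last.
  - exact: measurable_funeM.
  - by move=> x _; rewrite -EFinM lee_fin mulr_ge0 ?powR_ge0.
  - by move=> x _; rewrite lee_fin ltW.
  apply: leeD.
    rewrite -EFin_Rintegral_itv; last exact: integrable_cst_itv.
    by rewrite Rintegral_cst_itv// addrAC subrr add0r mulr1.
  rewrite ge0_integralZl//; [|by rewrite lee_fin powR_ge0].
  apply: lee_wpmul2l; first by rewrite lee_fin powR_ge0.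
  apply: ge0_subset_integral.
  - exact: measurable_itvcc.
  - exact: measurableT.
  - by apply/measurable_EFinP.
  - by move=> x _; rewrite lee_fin powR_ge0.
  - by [].
have J0 : (0 <= \int[mu]_(x in `[a, (a + 1)%R]) `|f x|%:E)%E by exact: integral_ge0.
have Jfin : (\int[mu]_(x in `[a, (a + 1)%R]) `|f x|%:E)%E \is a fin_num.
  by rewrite ge0_fin_numE// (le_lt_trans (bound 1 ltr01))// ltry.
rewrite -(fineK Jfin) lee_fin; apply: (young_powR_optimal p1) => // c c0.
by rewrite -lee_fin fineK// bound.
Qed.

Lemma sobolev_patch_integrable delta p h : 1 <= p -> sobolev delta p h ->
  mu.-integrable setT (EFin \o (h \_ I01)).
Proof.
move=> p1 /sobolevP -/(_ (lt_le_trans ltr01 p1)) [_ mH Noo _].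
have := integral_norm_Lnorm 0 p1 mH Noo; rewrite add0r => le2N.
rewrite (_ : h \_ I01 = (h \_ I01) \_ I01); last first.
  by apply/funext => x; rewrite [RHS]patchE; case: ifPn => // ?; rewrite patchE ifN.
rewrite -restrict_EFin; apply: (iffLR (integrable_mkcond _ (measurable_itvcc 0 1))).
apply/integrableP; split; first by apply/measurable_EFinP; exact: measurable_funTS.
exact: le_lt_trans le2N (ltry _).
Qed.

Lemma sobolev_linear delta p (a : R) h1 h2 : 1 <= p ->
  sobolev delta p h1 -> sobolev delta p h2 ->
  sobolev delta p (fun x => a * h1 x + h2 x).
Proof.
move=> p1; have p0 : 0 < p by rewrite (lt_le_trans ltr01).
move=> /(sobolevP _ _ p0)[mh1 mH1 N1 E1] /(sobolevP _ _ p0)[mh2 mH2 N2 E2].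
apply/(sobolevP _ _ p0).
have HE : (fun x => a * h1 x + h2 x) \_ I01 =
    (fun x => a * (h1 \_ I01) x + (h2 \_ I01) x).
  by apply/funext => x; rewrite !patchE; case: ifP; rewrite ?mulr0 ?addr0.
rewrite HE.
have mah : measurable_fun setT (fun x => a * (h1 \_ I01) x + (h2 \_ I01) x).
  by apply: measurable_funD => //; exact: measurable_funM.
have mp (f : R -> R) : measurable_fun setT f ->
    measurable_fun setT (fun x => `|f x| `^ p).
  move=> mf.
  by apply: (measurableT_comp (measurable_powR _)); exact: measurableT_comp.
have Ap x y : `|a * x + y| `^ p <=
    (2 `^ p * `|a| `^ p) * `|x| `^ p + 2 `^ p * `|y| `^ p.
  apply: (le_trans (powR_normD_le _ _ p1)).
  by rewrite normrM powRM// mulrDr mulrA.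
split; [by apply: measurable_funD => //; exact: measurable_funM|exact: mah| |].
- apply: (ge0_integral_lty_comb (a := 2 `^ p * `|a| `^ p) (b := 2 `^ p)
    _ _ _ _ _ _ _ _ _ _ N1 N2).
  + exact: measurableT.
  + exact: mp.
  + exact: mp.
  + exact: mp.
  + by move=> x; exact: powR_ge0.
  + by move=> x; exact: powR_ge0.
  + by move=> x; exact: powR_ge0.
  + by rewrite mulr_ge0// powR_ge0.
  + exact: powR_ge0.
  + by move=> x; exact: Ap.
- apply: (ge0_integral_lty_comb (a := 2 `^ p * `|a| `^ p) (b := 2 `^ p)
    _ _ _ _ _ _ _ _ _ _ E1 E2).
  + exact: measurable_sq.
  + exact: measurable_slobodeckij_kernel.
  + exact: measurable_slobodeckij_kernel.
  + exact: measurable_slobodeckij_kernel.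
  + exact: slobodeckij_kernel_ge0.
  + exact: slobodeckij_kernel_ge0.
  + exact: slobodeckij_kernel_ge0.
  + by rewrite mulr_ge0 ?powR_ge0.
  + exact: powR_ge0.
  + move=> z; rewrite /slobodeckij_kernel !mulrA -mulrDl.
    rewrite ler_wpM2r ?invr_ge0 ?powR_ge0//.
    rewrite (_ : _ - _ = a * ((h1 \_ I01) z.2 - (h1 \_ I01) z.1) +
       ((h2 \_ I01) z.2 - (h2 \_ I01) z.1)); last by ring.
    exact: Ap.
Qed.

End sobolev_functions.

Lemma powR_cvg_nneg (R : realType) (T : Type) (F : set_system T) (f : T -> R)
    (l a : R) : Filter F -> 0 < a -> 0 <= l -> (\forall x \near F, 0 <= f x) ->
  f @ F --> l -> (fun x => f x `^ a) @ F --> l `^ a.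
Proof.
move=> FF a0 l0 f0 fl.
have [l_eq0|l_neq0] := eqVneq l 0; last first.
  have lgt0 : 0 < l by rewrite lt_neqAle eq_sym l_neq0.
  apply: (@cvg_comp _ _ _ f (fun y : R => y `^ a) F (nbhs l)) => //.
  have : derivable (fun y : R => y `^ a) l 1.
    by apply: derivable_powR; rewrite in_itv/= andbT.
  by move=> /derivable1_diffP/differentiable_continuous.
rewrite l_eq0 powR0 ?gt_eqF//; rewrite l_eq0 in fl.
apply/cvgrPdistC_le => e e0.
have ea : 0 < e `^ a^-1 by rewrite powR_gt0.
have /cvgr0_norm_lt/(_ _ ea) := fl; apply: filterS2 f0 => x fx0 fxe.
rewrite subr0 ger0_norm ?powR_ge0//.
rewrite -(powRr1 (ltW e0)) -(mulVf (lt0r_neq0 a0)) powRrM.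
by rewrite ge0_ler_powR ?nnegrE ?powR_ge0 ?(ltW a0)// ltW// -(ger0_norm fx0).
Qed.

Lemma hoelder_superadditive (R : realType) (r a b c d : R) :
  0 < r -> r < 1 -> 0 <= a -> 0 <= b -> 0 <= c -> 0 <= d ->
  a `^ r * b `^ (1 - r) + c `^ r * d `^ (1 - r) <=
  (a + c) `^ r * (b + d) `^ (1 - r).
Proof.
move=> r0 r1 a0 b0 c0 d0; have r'0 : 0 < 1 - r by rewrite subr_gt0.
have := @hoelder2 _ (a `^ r) (c `^ r) (b `^ (1 - r)) (d `^ (1 - r)) r^-1 (1 - r)^-1.
rewrite -!powRrM !mulfV ?gt_eqF// !powRr1// !invrK.
by apply; rewrite ?powR_ge0 ?invr_gt0// addrC subrK.
Qed.

Section control.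
Context {R : realType}.
Local Notation mu := (@lebesgue_measure R).
Implicit Types (g : R -> R) (a b c q : R) (w : R -> R -> R).

Lemma sum_control g w q C a b (l : seq R) : 0 <= C ->
  (forall x y, a <= x -> x <= y -> y <= b ->
     `|g y - g x| `^ q <= C * w x y) ->
  (forall x y z, a <= x -> x <= y -> y <= z -> z <= b ->
     w x y + w y z <= w x z) ->
  (0 <= w b b) ->
  itv_partition a b l ->
  \sum_(0 <= i < size l)
    `|g (nth b (a :: l) i.+1) - g (nth b (a :: l) i)| `^ q <= C * w a b.
Proof.
move=> C0; elim: l a => [|x l IH] a gw wD wbb abl.
  rewrite big_nil (itv_partition_nil abl); exact: mulr_ge0.
have [/= ax xl] : a < x /\ itv_partition x b l.
  split; last exact: itv_partition_cons abl.
  by case: abl => /= /andP[].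
have xb := itv_partition_le xl.
rewrite /= big_nat_recl//=.
apply: (@le_trans _ _ (C * w a x + C * w x b)); last first.
  by rewrite -mulrDr ler_wpM2l// wD// ltW.
apply: lerD; first by apply: gw => //; exact: ltW.
apply: IH => //.
  by move=> y z xy yz zb; apply: gw => //; rewrite (le_trans (ltW ax)).
by move=> y z t xy yz zt tb; apply: wD => //; rewrite (le_trans (ltW ax)).
Qed.

Lemma qvar_control g w q C a b : 0 < q -> 0 <= C ->
  (forall x y, a <= x -> x <= y -> y <= b ->
     `|g y - g x| `^ q <= C * w x y) ->
  (forall x y z, a <= x -> x <= y -> y <= z -> z <= b ->
     w x y + w y z <= w x z) ->
  (0 <= w b b) ->
  (qvar q g a b <= ((C * w a b) `^ q^-1)%:E)%E.
Proof.
move=> q0 C0 gw wD wbb; apply: ge_ereal_sup => _ [l /= abl <-].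
have s0 : 0 <= \sum_(0 <= i < size l)
    `|g (nth b (a :: l) i.+1) - g (nth b (a :: l) i)| `^ q.
  by apply: sumr_ge0 => i _; exact: powR_ge0.
have sw := sum_control C0 gw wD wbb abl.
rewrite lee_fin ge0_ler_powR ?nnegrE ?invr_ge0 ?(ltW q0)//.
exact: le_trans sw.
Qed.

Lemma qvar_ge0 g q a b : a <= b -> (0 <= qvar q g a b)%E.
Proof.
rewrite le_eqVlt => /predU1P[->|ab].
  apply: (@le_trans _ _ ((0 `^ q^-1)%R)%:E); first by rewrite lee_fin powR_ge0.
  apply: ereal_sup_ubound; exists [::]; first by split => /=.
  by rewrite big_nil.
apply: (@le_trans _ _ ((\sum_(0 <= i < size [:: b])
      `|g (nth b (a :: [:: b]) i.+1) - g (nth b (a :: [:: b]) i)| `^ q) `^ q^-1)%:E).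
  by rewrite lee_fin powR_ge0.
by apply: ereal_sup_ubound; exists [:: b] => //; exact: itv_partition1.
Qed.

End control.

Section sobolev_control.
Context {R : realType}.
Local Notation mu := (@lebesgue_measure R).
Context (delta p : R) (h : R -> R).
Context (delta0 : 0 < delta) (p1 : 1 <= p)
  (alpha0 : 0 < delta - p^-1).
Context (mh : measurable_fun setT h).
Context (Eoo : (energy delta p h 0 1 < +oo)%E).

Let r : R := (delta * p)^-1.
Let p0 : 0 < p. Proof. by rewrite (lt_le_trans ltr01). Qed.
Let dp : 1 < delta * p.
Proof. by rewrite -(mulVf (lt0r_neq0 p0)) ltr_pM2r// -subr_gt0. Qed.
Let dp0 : 0 < delta * p. Proof. exact: lt_trans ltr01 dp. Qed.
Let r0 : 0 < r. Proof. by rewrite invr_gt0. Qed.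
Let r1 : r < 1. Proof. by rewrite invf_lt1. Qed.

Definition sobolev_control (s t : R) : R :=
  fine (energy delta p h s t) `^ r * (t - s) `^ (1 - r).

Lemma sobolev_controlE s t : 0 <= s -> s <= t -> t <= 1 ->
  (slobodeckij delta p h s t `^ delta^-1 *
    ((t - s) `^ ((delta - p^-1) * delta^-1))%:E)%E = (sobolev_control s t)%:E.
Proof.
move=> s0 st t1; rewrite slobodeckijE -poweRrM -invfM (mulrC p) -/r.
rewrite (_ : _ * delta^-1 = 1 - r); last first.
  by rewrite /r invfM mulrBl mulfV ?gt_eqF// [p^-1 * _]mulrC.
rewrite -(fineK (energy_fin_num mh Eoo s0 t1)) poweR_EFin.
by rewrite -EFinM.
Qed.

Lemma sobolev_control_ge0 s t : 0 <= sobolev_control s t.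
Proof. by rewrite mulr_ge0 ?powR_ge0. Qed.

Lemma sobolev_controlD s t u : 0 <= s -> s <= t -> t <= u -> u <= 1 ->
  sobolev_control s t + sobolev_control t u <= sobolev_control s u.
Proof.
move=> s0 st tu u1.
have t0 : 0 <= t by exact: le_trans st.
have t1 : t <= 1 by exact: le_trans u1.
have E0 x y : 0 <= fine (energy delta p h x y) by rewrite fine_ge0// energy_ge0.
apply: (le_trans (hoelder_superadditive _ _ _ _ _ _)) => //.
- by rewrite subr_ge0.
- by rewrite subr_ge0.
rewrite (_ : t - s + (u - t) = u - s); last by ring.
apply: ler_wpM2r; first exact: powR_ge0.
rewrite ge0_ler_powR ?nnegrE ?addr_ge0 ?(ltW r0)//.
rewrite -fineD ?energy_fin_num//.
have pn0 : p != 0 by rewrite gt_eqF.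
apply: fine_le (energyD delta pn0 mh st tu).
  by rewrite fin_numD !energy_fin_num.
exact: energy_fin_num.
Qed.

Lemma sobolev_control_continuous :
  {within simplex, continuous (fun z : R * R => (sobolev_control z.1 z.2)%:E)}.
Proof.
apply/subspace_continuousP => z sz.
rewrite /from_subspace/=.
apply: cvg_EFin; first exact: nearW.
case: (sz) => z0 z12 z1.
have FF : Filter (within simplex (nbhs z)) by exact: within_filter.
have simp : \forall y \near within simplex (nbhs z), simplex y.
  by rewrite near_withinE; apply: nearW.
apply: cvgM.
  apply: powR_cvg_nneg => //.
  - by rewrite fine_ge0// energy_ge0.
  - by apply: nearW => y; rewrite fine_ge0// energy_ge0.
  apply/cvgrPdist_le => e e0.
  have [d d0 dP] := energy_continuity mh Eoo e0.
  have : \forall y \near within simplex (nbhs z), ball z d y.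
    by apply: cvg_within; exact: nbhsx_ballx.
  apply: filterS2 simp => y [y0 y12 y1] [/= zy1 zy2].
  have yz1 : `|y.1 - z.1| < d by rewrite distrC.
  have yz2 : `|y.2 - z.2| < d by rewrite distrC.
  have := dP _ _ _ _ z0 z1 y0 y1 zy1 zy2.
  have := dP _ _ _ _ y0 y1 z0 z1 yz1 yz2.
  set u := fine _; set v := fine _ => *.
  by rewrite ler_norml; apply/andP; split; lra.
apply: powR_cvg_nneg => //.
- by rewrite subr_gt0.
- by rewrite subr_ge0.
- by apply: filterS simp => y [y0 y12 y1]; rewrite subr_ge0.
by apply: cvgB; apply: cvg_within_filter; [exact: cvg_snd|exact: cvg_fst].
Qed.

End sobolev_control.

Section sobolev_representative.
Context {R : realType}.
Local Notation mu := (@lebesgue_measure R).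
Local Notation I01 := (`[0%R, 1%R]%classic : set R).
Implicit Types (g h : R -> R) (x y a : R).
Context (delta p : R).
Context (delta0 : 0 < delta) (p1 : 1 <= p)
  (alpha0 : 0 < delta - p^-1).

Let p0 : 0 < p. Proof. by rewrite (lt_le_trans ltr01). Qed.

Local Notation K := (campanato_cst delta p).
Let K0 : 0 <= K. Proof. exact: campanato_cst_ge0. Qed.

Definition sobolev_representative h : R -> R := representative (h \_ I01).

Local Notation J := sobolev_representative.
Local Notation S h := (fine (slobodeckij delta p h 0 1)).
Local Notation N h := (fine ('N[mu]_(p%:E)[EFin \o (h \_ I01)])%E).

Let patchP h : sobolev delta p h ->
  [/\ measurable_fun setT (h \_ I01),
      mu.-integrable `[0, 1] (EFin \o (h \_ I01)) &
      (energy delta p (h \_ I01) 0 1 < +oo)%E].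
Proof.
move=> sh; have [_ mH _ Eoo] := (sobolevP _ _ p0).1 sh; split => //.
apply: integrableS (sobolev_patch_integrable p1 sh).
- exact: measurableT.
- exact: measurable_itvcc.
- exact: subsetT.
Qed.

Let slobodeckij_fineE h :
  S h = fine (energy delta p (h \_ I01) 0 1) `^ p^-1.
Proof. by rewrite (@slobodeckij_patch _ _ _ _ 0 1)// slobodeckijE fine_poweR. Qed.

Let S0 h : 0 <= S h. Proof. by rewrite fine_ge0// poweR_ge0. Qed.

Lemma sobolev_representative_control h x y : sobolev delta p h ->
  0 <= x -> x <= y -> y <= 1 ->
  `|J h y - J h x| `^ delta^-1 <=
  (2 * K) `^ delta^-1 * sobolev_control delta p (h \_ I01) x y.
Proof.
move=> sh x0 xy y1; have [mH iH Eoo] := patchP sh.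
have yx0 : 0 <= y - x by rewrite subr_ge0.
apply: (@le_trans _ _ ((2 * K * (y - x) `^ (delta - p^-1) *
    fine (energy delta p (h \_ I01) x y) `^ p^-1) `^ delta^-1)).
  rewrite ge0_ler_powR ?invr_ge0 ?(ltW delta0)//.
  - by rewrite nnegrE; apply: mulr_ge0; rewrite ?powR_ge0// mulr_ge0 ?powR_ge0// mulr_ge0.
  - exact: representative_holder.
rewrite powRM ?powR_ge0//; last by rewrite mulr_ge0 ?powR_ge0// mulr_ge0.
rewrite powRM ?powR_ge0//; last by rewrite mulr_ge0.
rewrite -!powRrM -mulrA /sobolev_control [X in _ <= _ * X]mulrC.
rewrite (_ : (delta - p^-1) * delta^-1 = 1 - (delta * p)^-1); last first.
  by field; rewrite !gt_eqF.
by rewrite -invfM [p * _]mulrC.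
Qed.

Lemma sobolev_representative_holder h x y : sobolev delta p h ->
  0 <= x -> x <= y -> y <= 1 ->
  `|J h y - J h x| <= 2 * K * S h * (y - x) `^ (delta - p^-1).
Proof.
move=> sh x0 xy y1; have [mH iH Eoo] := patchP sh.
apply: (le_trans (representative_holder p1 delta0 alpha0 mH iH Eoo x0 xy y1)).
rewrite slobodeckij_fineE -!(mulrA (2 * K)); apply: ler_wpM2l.
  by rewrite mulr_ge0.
rewrite mulrC; apply: ler_wpM2r; first exact: powR_ge0.
exact: energy_root_le.
Qed.

Lemma sobolev_representative_continuous h : sobolev delta p h ->
  {within I01, continuous (J h)}.
Proof.
move=> sh; apply/subspace_continuousP => x x01; rewrite /from_subspace.
have FF : Filter (within I01 (nbhs x)) by exact: within_filter.
apply/cvgrPdistC_le => e e0.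
have normx : (fun y => `|y - x|) @ within I01 (nbhs x) --> (0 : R).
  have yx : y - x @[y --> within I01 (nbhs x)] --> x - x.
    by apply: cvgB; [exact: cvg_within|exact: cvg_cst].
  by have := cvg_norm yx; rewrite subrr normr0; apply.
have : (fun y => `|y - x| `^ (delta - p^-1)) @ within I01 (nbhs x) --> (0 : R).
  have := powR_cvg_nneg FF alpha0 (lexx 0) _ normx.
  by rewrite powR0 ?gt_eqF//; apply; apply: nearW => y; exact: normr_ge0.
move=> /(cvgM (cvg_cst (2 * K * S h))); rewrite mulr0.
move=> /cvgr0_norm_le/(_ _ e0); rewrite !near_withinE.
apply: filterS => y ye y01; move: (ye y01); apply: le_trans.
have KS : 0 <= 2 * K * S h by apply: mulr_ge0 => //; exact: mulr_ge0.
rewrite /= [leRHS]ger0_norm; last by rewrite mulr_ge0 ?powR_ge0.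
move: x01 y01; rewrite /= !in_itv/= => /andP[x0 x1] /andP[y0 y1].
have [xy|yx] := leP x y.
  by rewrite [`|y - x|]ger0_norm ?subr_ge0// sobolev_representative_holder.
rewrite distrC [`|y - x|]ler0_norm ?subr_le0 ?(ltW yx)// opprB.
by rewrite sobolev_representative_holder// ltW.
Qed.

Lemma sobolev_continuous_representative h : sobolev delta p h ->
  continuous_representative h (J h).
Proof.
move=> sh; split; first exact: sobolev_representative_continuous.
have := representative_ae_eq (sobolev_patch_integrable p1 sh).
apply: (@filterS _ _ (ae_filter_ringOfSetsType mu)) => x + x01.
by rewrite {1}patchE mem_set.
Qed.

Lemma sobolev_representative_unique h g x : sobolev delta p h ->
  continuous_representative h g -> 0 <= x <= 1 -> J h x = g x.
Proof.
move=> sh [cg hg] x01; have [mH _ _] := patchP sh.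
apply: representative_unique => //; split => //.
apply: (@filterS _ _ (ae_filter_ringOfSetsType mu)) hg => y + y01.
by rewrite patchE mem_set// => /(_ y01).
Qed.

Lemma sobolev_representative_linear a h1 h2 x : sobolev delta p h1 ->
  sobolev delta p h2 -> 0 <= x <= 1 ->
  J (fun y => a * h1 y + h2 y) x = a * J h1 x + J h2 x.
Proof.
move=> s1 s2 x01.
have s12 := sobolev_linear a p1 s1 s2.
have [c1 e1] := sobolev_continuous_representative s1.
have [c2 e2] := sobolev_continuous_representative s2.
apply: (sobolev_representative_unique (g := fun x => a * J h1 x + J h2 x) s12) => //.
split.
  apply: (@within_continuousD _ R R^o) => //.
  by move=> z; apply: cvgMl_tmp; exact: c1.
by apply: (@filterS2 _ _ (ae_filter_ringOfSetsType mu)) e1 e2 => y + + y01 => -> // ->.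
Qed.

Lemma sobolev_representative_bound h x : sobolev delta p h -> 0 <= x <= 1 ->
  `|J h x| <= 2 * N h + K * S h.
Proof.
move=> sh x01; have [mH iH Eoo] := patchP sh.
rewrite -[J h x](subrK (average (h \_ I01) 0 1)) addrC.
apply: (le_trans (ler_normD _ _)); apply: lerD; last first.
  apply: le_trans (representative_average p1 delta0 alpha0 mH iH Eoo _ _ _ _) _ => //.
  by rewrite slobodeckij_fineE subr0 powR1 mulr1.
rewrite /average subr0 divr1.
apply: (le_trans (le_normr_Rintegral (measurable_itvcc 0 1) iH)).
rewrite -lee_fin EFin_Rintegral_itv; last exact: integrable_norm.
have [_ _ Noo _] := (sobolevP _ _ p0).1 sh.
by have := integral_norm_Lnorm 0 p1 mH Noo; rewrite add0r.
Qed.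

Lemma sup_norm_le h : sobolev delta p h ->
  (sup_norm (J h) <= (2 * N h + K * S h)%:E)%E.
Proof.
move=> sh; apply: ge_ereal_sup => _ [x x01 <-]; rewrite lee_fin.
by apply: sobolev_representative_bound => //; move: x01; rewrite /= in_itv.
Qed.

Lemma holder_seminorm_le h : sobolev delta p h ->
  (holder_seminorm (delta - p^-1) (J h) <= (2 * K * S h)%:E)%E.
Proof.
move=> sh; apply: ge_ereal_sup => _ [z [z1 z12 z2] <-]; rewrite lee_fin.
rewrite [`|z.2 - z.1|]gtr0_norm ?subr_gt0// ler_pdivrMr ?powR_gt0 ?subr_gt0//.
by apply: sobolev_representative_holder => //; exact: ltW.
Qed.

Lemma qvar_le h g a b : sobolev delta p h -> continuous_representative h g ->
  0 <= a -> a <= b -> b <= 1 ->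
  (qvar delta^-1 g a b <=
    (((2 * K) `^ delta^-1 * sobolev_control delta p (h \_ I01) a b) `^ delta)%:E)%E.
Proof.
move=> sh hg a0 ab b1; have [mH iH Eoo] := patchP sh.
rewrite -[X in (_ `^ X)%:E]invrK; apply: qvar_control.
- by rewrite invr_gt0.
- exact: powR_ge0.
- move=> x y ax xy yb.
  rewrite -(sobolev_representative_unique sh hg (x := x)); last first.
    by rewrite (le_trans a0 ax) (le_trans xy (le_trans yb b1)).
  rewrite -(sobolev_representative_unique sh hg (x := y)); last first.
    by rewrite (le_trans a0 (le_trans ax xy)) (le_trans yb b1).
  by apply: sobolev_representative_control => //;
    [exact: le_trans ax|exact: le_trans b1].
- move=> x y z ax xy yz zb; apply: sobolev_controlD => //.
  + exact: le_trans ax.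
  + exact: le_trans b1.
- exact: sobolev_control_ge0.
Qed.

Lemma qvar_representative_le h : sobolev delta p h ->
  (qvar delta^-1 (J h) 0 1 <= (2 * K * S h)%:E)%E.
Proof.
move=> sh.
apply: (le_trans (qvar_le sh (sobolev_continuous_representative sh) _ _ _)) => //.
rewrite lee_fin /sobolev_control subr0 powR1 mulr1.
rewrite powRM ?powR_ge0// -!powRrM mulVf ?gt_eqF// powRr1; last exact: mulr_ge0.
rewrite slobodeckij_fineE (_ : (delta * p)^-1 * delta = p^-1)//.
by rewrite invfM mulrAC mulVf ?gt_eqF// mul1r.
Qed.

Lemma sobolev_norm_fineE h : sobolev delta p h ->
  sobolev_norm delta p h = (N h + S h)%:E.
Proof.
move=> [_]; rewrite /sobolev_norm => noo.
have NN : (0 <= 'N[mu]_(p%:E)[EFin \o (h \_ I01)])%E by exact: Lnorm_ge0.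
have SS : (0 <= slobodeckij delta p h 0 1)%E by exact: poweR_ge0.
rewrite EFinD !fineK// ge0_fin_numE//; apply: le_lt_trans noo.
  by rewrite leeDr.
by rewrite leeDl.
Qed.

Lemma sobolev_norm_dominates h (n : (R -> R) -> \bar R) : sobolev delta p h ->
  (n (J h) <= (2 * K * S h)%:E)%E ->
  (sup_norm (J h) + n (J h) <= (2 + 3 * K)%:E * sobolev_norm delta p h)%E.
Proof.
move=> sh nle; rewrite sobolev_norm_fineE// -EFinM.
apply: (le_trans (leeD (sup_norm_le sh) nle)); rewrite -EFinD lee_fin.
have N0 : 0 <= N h by rewrite fine_ge0// Lnorm_ge0.
have KN0 := mulr_ge0 K0 N0.
rewrite -subr_ge0 (_ : _ - _ = 3 * (K * N h) + 2 * S h); last by ring.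
by apply: addr_ge0; apply: mulr_ge0.
Qed.

End sobolev_representative.

Theorem theorem2 (R : realType) (delta p alpha q : R)
  (hdelta0 : (0 < delta)%R) (hdelta1 : (delta < 1)%R) (hp : (1 <= p)%R)
  (halpha : alpha = (delta - p^-1)%R) (halpha0 : (0 < alpha)%R)
  (hq : q = (delta^-1)%R) :
  let omega (h : R -> R) (s t : R) : \bar R :=
    (slobodeckij delta p h s t `^ q * ((t - s) `^ (alpha * q))%R%:E)%E in
  [/\ forall h, sobolev delta p h -> control_function (omega h),
      exists C : R, forall h g : R -> R,
        sobolev delta p h -> continuous_representative h g ->
        forall s t : R, (0 <= s)%R -> (s <= t)%R -> (t <= 1)%R ->
          (qvar q g s t `^ q <= C%:E * omega h s t)%E,
      continuous_embedding (sobolev delta p) (sobolev_norm delta p)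
        (holder_space alpha) (holder_norm alpha) &
      continuous_embedding (sobolev delta p) (sobolev_norm delta p)
        (qvar_space q) (qvar_norm q)].
Proof.
move=> omega; rewrite {}/omega; subst alpha q.
have p0 : (0 < p)%R by rewrite (lt_le_trans ltr01).
have omegaE h s t : sobolev delta p h -> (0 <= s)%R -> (s <= t)%R -> (t <= 1)%R ->
    (slobodeckij delta p h s t `^ delta^-1 *
      ((t - s) `^ ((delta - p^-1) * delta^-1))%R%:E)%E =
    (sobolev_control delta p (h \_ `[0%R, 1%R]%classic) s t)%:E.
  move=> /(sobolevP _ _ p0)[_ mH _ Eoo] s0 st t1.
  by rewrite (slobodeckij_patch _ _ _ s0 t1) sobolev_controlE.
split.
- move=> h sh; have [_ mH _ Eoo] := (sobolevP _ _ p0).1 sh; split.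
  + move=> s t [/= s0 st t1].
    by rewrite omegaE// lee_fin sobolev_control_ge0 ltry.
  + apply: (subspace_eq_continuous _
      (sobolev_control_continuous hp halpha0 mH Eoo)).
    move=> z /set_mem [z0 z12 z1]; rewrite /from_subspace.
    exact: esym (omegaE _ _ _ sh z0 z12 z1).
  + move=> s t u s0 st tu u1.
    have t0 := le_trans s0 st; have t1 := le_trans tu u1.
    rewrite !omegaE ?(le_trans st tu)// -EFinD lee_fin.
    exact: sobolev_controlD.
- exists ((2 * campanato_cst delta p) `^ delta^-1)%R => h g sh hg s t s0 st t1.
  have := qvar_le hdelta0 hp halpha0 sh hg s0 st t1.
  rewrite omegaE//; set w := (_ * _)%R => qw.
  have w0 : (0 <= w)%R.
    by rewrite mulr_ge0 ?powR_ge0// sobolev_control_ge0.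
  rewrite -EFinM -/w.
  have -> : w%:E = ((w `^ delta)%:E `^ delta^-1)%E.
    by rewrite poweR_EFin -powRrM mulfV ?gt_eqF// powRr1.
  apply: gt0_ler_poweR => //.
  + by rewrite invr_ge0 ltW.
  + by rewrite in_itv/= leey andbT qvar_ge0.
  + by rewrite in_itv/= leey andbT lee_fin powR_ge0.
- exists (sobolev_representative (R := R)); split.
  + move=> h sh; split.
      exact: (sobolev_continuous_representative hdelta0 hp halpha0 sh).
    exact: le_lt_trans (holder_seminorm_le hdelta0 hp halpha0 sh) (ltry _).
  + move=> a h1 h2 s1 s2; split; first exact: sobolev_linear.
    move=> x /set_mem; rewrite /= in_itv/= => x01.
    exact: (sobolev_representative_linear hdelta0 hp halpha0 a s1 s2 x01).
  + exists (2 + 3 * campanato_cst delta p)%R => h sh.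
    apply: sobolev_norm_dominates => //.
    exact: (holder_seminorm_le hdelta0 hp halpha0 sh).
- exists (sobolev_representative (R := R)); split.
  + move=> h sh; split.
      exact: (sobolev_continuous_representative hdelta0 hp halpha0 sh).
    split; first exact: (sobolev_representative_continuous hdelta0 hp halpha0 sh).
    exact: le_lt_trans
      (qvar_representative_le hdelta0 hp halpha0 sh) (ltry _).
  + move=> a h1 h2 s1 s2; split; first exact: sobolev_linear.
    move=> x /set_mem; rewrite /= in_itv/= => x01.
    exact: (sobolev_representative_linear hdelta0 hp halpha0 a s1 s2 x01).
  + exists (2 + 3 * campanato_cst delta p)%R => h sh.
    apply: (sobolev_norm_dominates hdelta0 hp halpha0
      (n := fun g => qvar delta^-1 g 0 1)) => //.
    exact: (qvar_representative_le hdelta0 hp halpha0 sh).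
Qed.
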